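(* Suppose that $R_1,R_2$ are two simply-connected regions in the plane, with mandated partial height functions $f_1,f_2$ along their boundaries (that is, $f_i$ is defined on the set of vertices on the boundary of $R_i$) that agree modulo $4$, such that every vertex $v_1$ on the boundary of $R_1$ is within sup-norm distance $\Delta_1$ of some vertex $v_2$ on the boundary of $R_2$, and vice versa, and such that whenever vertices $v_1$ and $v_2$ on the respective boundaries are within sup-norm distance $\Delta_1$ of each other, the heights $f_1(v_1)$ and $f_2(v_2)$ are within $\Delta_2$ of each other (i.e. $|f_1(v_1)-f_2(v_2)|\le\Delta_2$). Then, for any vertex $v$ in $R_1\cap R_2$, the expected value of $H(v)$ under $\mu_{f_1}$ and the expected value of $H(v)$ under $\mu_{f_2}$ differ by at most $2\Delta_1+\Delta_2+1$.
   Context: A region is a finite union of unit squares of the square lattice that can be tiled by dominos. The lattice squares are colored black and white in a fixed checkerboard coloring of the plane. A height function on a simply-connected region $R$ is an integer-valued function $h$ on the vertices of the lattice squares of $R$ such that, for adjacent vertices $u,v$ (joined by an edge of a lattice square of $R$): if the edge $uv$ is part of the boundary of $R$ then $|h(u)-h(v)|=1$, and if the directed edge from $u$ to $v$ has a black square on its left then $h(v)$ is either $h(u)+1$ or $h(u)-3$. Height functions correspond to domino tilings: the dominos are those bisected by the edges $uv$ with $|h(u)-h(v)|=3$; every tiling arises from a height function unique up to an additive constant, and once the height at one boundary vertex is fixed, all height functions agree on the boundary. A partial height function is an integer-valued function satisfying the constraint $f(v)-f(u)\in\{1,-3\}$ (for the directed edge from $u$ to $v$ having a black square on its left) on a connected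 subset of the vertices of $R$ containing all boundary vertices; it is complete if it is defined on all vertices of $R$, and a complete height function extends $f$ if it agrees with $f$ where $f$ is defined. The mandated partial height function along the boundary of $R_i$ is the common boundary restriction of the height functions of the tilings of $R_i$ (for some choice of additive constant). $\mu_{f}$ denotes the uniform distribution on the set of complete height functions extending $f$, and $H$ denotes a random complete height function. Two partial height functions defined on different sets agree modulo $4$ if all height functions extending them agree modulo $4$ (at the vertices where both are defined; the values of height functions modulo $4$ are determined on the plane's lattice by the value at a single point). *)

(* Defs.v *)
From mathcomp Require Import all_boot all_order all_algebra finmap.
From mathcomp Require Import all_classical all_reals all_analysis.

Set Implicit Arguments.
Unset Strict Implicit.
Unset Printing Implicit Defensive.

Import Order.TTheory GRing.Theory Num.Theory.
Import numFieldNormedType.Exports.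

Local Open Scope classical_set_scope.
Local Open Scope ring_scope.

(* A square is named by its lower left corner: (a, b) stands for the closed
   unit square [a, a + 1] x [b, b + 1]. *)
Definition vertex : Type := (int * int)%type.
Definition square : Type := (int * int)%type.

(* The four edges of the square s, directed counterclockwise, so that s is on
   the left of each of them. *)
Definition ccw_edges (s : square) : seq (vertex * vertex) :=
  let: (a, b) := s in
  [:: ((a, b), (a + 1, b)); ((a + 1, b), (a + 1, b + 1));
      ((a + 1, b + 1), (a, b + 1)); ((a, b + 1), (a, b))].

Definition on_left (s : square) (u v : vertex) : bool :=
  (u, v) \in ccw_edges s.

Definition corner (s : square) (v : vertex) : bool :=
  v \in unzip1 (ccw_edges s).

Definition adjacent_squares (s t : square) : Prop :=
  exists u v, on_left s u v /\ on_left t v u.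

Definition checkerboard (black : pred square) : Prop :=
  forall s t, adjacent_squares s t -> black t = ~~ black s.

Definition sup_dist (u v : vertex) : int :=
  Num.max `|u.1 - v.1| `|u.2 - v.2|.

(* In what follows a finite union of squares is given by the finite set D of
   its squares. *)

Definition vertices (D : {fset square}) : set vertex :=
  [set v | exists2 s, s \in D & corner s v].

Definition boundary_vertices (D : {fset square}) : set vertex :=
  [set v | vertices D v /\ exists2 s, s \notin D & corner s v].

Definition edge (D : {fset square}) (u v : vertex) : Prop :=
  exists2 s, s \in D & on_left s u v \/ on_left s v u.

Definition boundary_edge (D : {fset square}) (u v : vertex) : Prop :=
  edge D u v /\ exists2 s, s \notin D & on_left s u v \/ on_left s v u.

Definition domino (d : {fset square}) : Prop :=
  exists s t, adjacent_squares s t /\ d = [fset s; t]%fset.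

Definition tiling (D : {fset square}) (T : {fset {fset square}}) : Prop :=
  (forall d, d \in T -> domino d /\ (d `<=` D)%fset) /\
  (forall s, s \in D -> exists! d, d \in T /\ s \in d).

Definition region (D : {fset square}) : Prop := exists T, tiling D T.

Definition carrier (R : realType) (D : {fset square}) : set (R * R) :=
  [set p | exists2 s, s \in D &
     (s.1%:~R <= p.1 <= s.1%:~R + 1) && (s.2%:~R <= p.2 <= s.2%:~R + 1)].

Definition path_in (R : realType) (A : set (R * R)) (g : R -> R * R) : Prop :=
  {within `[0, 1], continuous g} /\ (forall t, 0 <= t <= 1 -> A (g t)).

Definition null_homotopic_in (R : realType) (A : set (R * R))
    (g : R -> R * R) : Prop :=
  exists H : R * R -> R * R,
    [/\ {within `[0, 1]%classic `*` `[0, 1]%classic, continuous H},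
        forall s t, 0 <= s <= 1 -> 0 <= t <= 1 -> A (H (s, t)),
        forall t, 0 <= t <= 1 -> H (0, t) = g t,
        forall t, 0 <= t <= 1 -> H (1, t) = g 0 &
        forall s, 0 <= s <= 1 -> H (s, 0) = g 0 /\ H (s, 1) = g 0].

Definition simply_connected (R : realType) (A : set (R * R)) : Prop :=
  [/\ A !=set0,
      forall x y, A x -> A y ->
        exists g, [/\ path_in A g, g 0 = x & g 1 = y] &
      forall g, path_in A g -> g 0 = g 1 -> null_homotopic_in A g].

(* Only the values of h at the vertices of D matter. *)
Definition height_function (black : pred square) (D : {fset square})
    (h : vertex -> int) : Prop :=
  forall u v, edge D u v ->
    (boundary_edge D u v -> `|h u - h v| = 1) /\
    (forall s, black s -> on_left s u v ->
       h v = h u + 1 \/ h v = h u - 3).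

(* T is the set of the dominos bisected by the edges of D across which h
   varies by 3. *)
Definition height_function_of_tiling (black : pred square)
    (D : {fset square}) (T : {fset {fset square}}) (h : vertex -> int) : Prop :=
  height_function black D h /\
  forall d, d \in T <->
    exists u v s t, [/\ edge D u v, `|h u - h v| = 3,
                        on_left s u v, on_left t v u & d = [fset s; t]%fset].

(* The additive constant of the height function may depend on the tiling; it is
   determined by f. *)
Definition mandated_boundary (black : pred square) (D : {fset square})
    (f : vertex -> int) : Prop :=
  forall T, tiling D T ->
    exists2 h, height_function_of_tiling black D T h &
      {in boundary_vertices D, h =1 f}.

(* The complete height functions on D that extend f, where f is considered as
   defined on S only. So that each is counted once, they are represented by
   their extension by 0 to all lattice points. *)
Definition extensions (black : pred square) (D : {fset square})
    (S : set vertex) (f : vertex -> int) : set {fsfun vertex -> int with 0} :=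
  [set h | [/\ height_function black D h,
               {in S, h =1 f} &
               forall v, ~ vertices D v -> h v = 0]].

Definition agree_mod4 (black : pred square)
    (D1 : {fset square}) (S1 : set vertex) (f1 : vertex -> int)
    (D2 : {fset square}) (S2 : set vertex) (f2 : vertex -> int) : Prop :=
  forall h1 h2, extensions black D1 S1 f1 h1 -> extensions black D2 S2 f2 h2 ->
  forall v, vertices D1 v -> vertices D2 v -> (h1 v = h2 v %[mod 4])%Z.

(* The expectation of H(v) for H uniform on [extensions black D S f]. This set
   is finite when S contains the boundary vertices of D: each vertex of D is
   joined to a boundary vertex by edges of D, along which heights vary by at
   most 3. *)
Definition expected_height (R : realType) (black : pred square)
    (D : {fset square}) (S : set vertex) (f : vertex -> int) (v : vertex) : R :=
  let E := fset_set (extensions black D S f) in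
  (\sum_(h <- E) (h v)%:~R) / #|` E|%:R.

Arguments carrier : clear implicits.
Arguments expected_height : clear implicits.

(* Main.v *)
(* Take independent H1 and H2. On the common vertices H1 - H2 takes values in
   4Z, and along an edge it changes by 0 or by 4 in absolute value. From a
   vertex of a region, a staircase with black squares on its left (or one with
   white squares) towards a nearby boundary vertex raises (or lowers) the height
   by at most 2 per unit of sup-norm distance (plus 1); it is
   stopped at the first boundary vertex that it meets, so it never leaves the
   region. Hence |H1 - H2| <= K = 2 Delta1 + Delta2 + 1 at the common vertices
   that lie on either boundary, and there H1 - H2 <= c, where c is the largest
   multiple of 4 up to K. If H1(v) - H2(v) > c, the connected component of v in
   {H1 - H2 <> c} avoids both boundaries and is surrounded by vertices where
   H1 = H2 + c, so one can exchange H1 with H2 + c on it. This is an injection of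
   pairs that reflects H1(v) - H2(v) in c, whence E(H1(v) - H2(v)) <= c <= K. *)
Require Import Defs.
From mathcomp Require Import all_boot all_order all_algebra finmap.
From mathcomp Require Import all_classical all_reals all_analysis.
From mathcomp Require Import zify ring lra.

Local Open Scope classical_set_scope.
Local Open Scope ring_scope.
Import Order.TTheory GRing.Theory Num.Theory.

Set Implicit Arguments.
Unset Strict Implicit.

(** * Edges, neighbors and interior vertices of the lattice *)

Lemma on_leftP (s : square) (u v : vertex) : on_left s u v ->
  (u = (s.1, s.2) /\ v = (s.1 + 1, s.2)) \/
  (u = (s.1 + 1, s.2) /\ v = (s.1 + 1, s.2 + 1)) \/
  (u = (s.1 + 1, s.2 + 1) /\ v = (s.1, s.2 + 1)) \/
  (u = (s.1, s.2 + 1) /\ v = (s.1, s.2)).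
Proof.
case: s => a b; rewrite /on_left /= !inE.
by case/or4P => /eqP [-> ->]; tauto.
Qed.

Lemma on_left_corner (s : square) (u v : vertex) :
  on_left s u v -> corner s u /\ corner s v.
Proof.
move/on_leftP; case: s => a b; rewrite /corner /= !inE.
by case=> [|[|[|]]] [-> ->]; rewrite !eqxx ?orbT.
Qed.

Definition neighbors (u v : vertex) : Prop :=
  exists s, on_left s u v \/ on_left s v u.

Lemma on_left_across (s : square) (u v : vertex) : on_left s u v ->
  exists2 t, on_left t v u & adjacent_squares s t.
Proof.
move=> suv; suff [t tvu] : exists t, on_left t v u by exists t => //; exists u, v.
case/on_leftP: suv; case: s => a b /=.
move=> [-> ->]; exists (a, b - 1); rewrite /on_left /= !inE subrK eqxx ?orbT//.
case=> [|[]] [-> ->].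
- by exists (a + 1, b); rewrite /on_left /= !inE eqxx ?orbT.
- by exists (a, b + 1); rewrite /on_left /= !inE eqxx ?orbT.
- by exists (a - 1, b); rewrite /on_left /= !inE subrK eqxx ?orbT.
Qed.

Lemma neighbors_left (u v : vertex) : neighbors u v ->
  exists s, on_left s u v.
Proof. by case=> s [|/on_left_across[t]]; [exists s | exists t]. Qed.

Lemma neighbors_sym (u v : vertex) : neighbors u v -> neighbors v u.
Proof. by case=> s []; exists s; [right|left]. Qed.

Definition interior_vertex (D : {fset square}) (u : vertex) : Prop :=
  forall s, corner s u -> s \in D.

Lemma boundary_or_interior (D : {fset square}) (u : vertex) :
  vertices D u -> boundary_vertices D u \/ interior_vertex D u.
Proof.
move=> Du; have [?|nb] := pselect (boundary_vertices D u); [by left|right].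
move=> s su; apply/negPn/negP => sD; apply: nb; split=> //; by exists s.
Qed.

(** Both squares flanking an edge at [u] have [u] as a corner and so lie in [D]. Hence walks and
    exchanges that move from interior vertices stay in the region. *)
Lemma interior_neighbor (D : {fset square}) (u v : vertex) :
  interior_vertex D u -> neighbors u v ->
  [/\ edge D u v, ~ boundary_edge D u v & vertices D v].
Proof.
move=> Iu; have inD s : on_left s u v \/ on_left s v u -> s \in D.
  by case=> /on_left_corner [? ?]; apply: Iu.
move=> uv; have [s suv] := neighbors_left uv.
split; first by exists s; [apply: inD; left | left].
  by case=> _ [t /negP tD tuv]; apply: tD; apply: inD.
by exists s; [apply: inD; left | have [] := on_left_corner suv].
Qed.

Lemma edge_sym (D : {fset square}) (u v : vertex) : edge D u v -> edge D v u.
Proof. by case=> s sD [?|?]; exists s => //; [right|left]. Qed.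

(** * Staircase walks towards the boundary, for either color of the checkerboard *)

Section Walk.
Variable color : pred square.
Hypothesis hcolor : checkerboard color.

Lemma color_right (u : vertex) : color (u.1 + 1, u.2) = ~~ color u.
Proof.
case: u => a b /=; apply: hcolor.
by exists (a + 1, b), (a + 1, b + 1); split; rewrite /on_left /= !inE eqxx ?orbT.
Qed.

Lemma color_up (u : vertex) : color (u.1, u.2 + 1) = ~~ color u.
Proof.
case: u => a b /=; apply: hcolor.
by exists (a + 1, b + 1), (a, b + 1); split; rewrite /on_left /= !inE eqxx ?orbT.
Qed.

Lemma color_left (u : vertex) : color (u.1 - 1, u.2) = ~~ color u.
Proof.
by case: u => a b; have := color_right (a - 1, b); rewrite /= subrK => ->; rewrite negbK.
Qed.

Lemma color_down (u : vertex) : color (u.1, u.2 - 1) = ~~ color u.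
Proof.
by case: u => a b; have := color_up (a, b - 1); rewrite /= subrK => ->; rewrite negbK.
Qed.

(** [color u] reads [u] as the square at its upper right, which is on the left of the edge going
    right. The edge going left has on its left the diagonally opposite square, of the same color. *)
Lemma horizontal_step (u : vertex) (e : int) : e = 1 \/ e = -1 -> color u ->
  exists2 s, color s & on_left s u (u.1 + e, u.2).
Proof.
case: u => a b [->|->] cu.
  by exists (a, b); rewrite // /on_left /= !inE eqxx.
exists (a - 1, b - 1).
  by have := color_left (a, b - 1); rewrite /= (color_down (a, b)) negbK => ->.
by rewrite /on_left /= !inE !subrK eqxx ?orbT.
Qed.

Lemma vertical_step (u : vertex) (e : int) : e = 1 \/ e = -1 -> ~~ color u ->
  exists2 s, color s & on_left s u (u.1, u.2 + e).
Proof.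
case: u => a b [->|->] cu.
  exists (a - 1, b); first by rewrite (color_left (a, b)).
  by rewrite /on_left /= !inE !subrK eqxx ?orbT.
exists (a, b - 1); first by rewrite (color_down (a, b)).
by rewrite /on_left /= !inE !subrK eqxx ?orbT.
Qed.

(* The two steps of the staircase are ordered so as to have colored squares on their left. *)
Lemma diagonal_step (u : vertex) (e e' : int) :
  e = 1 \/ e = -1 -> e' = 1 \/ e' = -1 ->
  exists m s s', [/\ color s, color s', on_left s u m,
    on_left s' m (u.1 + e, u.2 + e') & sup_dist u m <= 1].
Proof.
move=> he he'; case cu: (color u).
  have [s cs sl] := horizontal_step he cu.
  have [|s' cs' sl'] := @vertical_step (u.1 + e, u.2) e' he'.
    by case: he => ->; rewrite ?color_right ?color_left cu.
  by exists (u.1 + e, u.2), s, s'; split=> //; rewrite /sup_dist /=; lia.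
have [s cs sl] := vertical_step he' (negbT cu).
have [|s' cs' sl'] := @horizontal_step (u.1, u.2 + e') e he.
  by case: he' => ->; rewrite ?color_up ?color_down cu.
by exists (u.1, u.2 + e'), s, s'; split=> //; rewrite /sup_dist /=; lia.
Qed.

Variables (D : {fset square}) (h : vertex -> int).
Hypothesis step_bound : forall s u v, edge D u v -> color s -> on_left s u v ->
  h v <= h u + 1 /\ h u <= h v + 3.

(** Induction on [n]: a diagonal step lowers the bound on the distance to [t] by 1 and raises the
    height by at most 2. The walk stops at its first boundary vertex, so its edges all lie in [D].
    As a corner of a square outside [D], [t] cannot be interior, so the walk stops there at the
    latest. *)
Lemma height_near_boundary (s0 : square) (t : vertex) :
  s0 \notin D -> corner s0 t ->
  forall (n : nat) (u : vertex), vertices D u -> sup_dist u t <= n%:Z ->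
  exists w, [/\ boundary_vertices D w, sup_dist u w <= n%:Z &
                h w <= h u + 2 * n%:Z + 1].
Proof.
move=> s0D s0t.
have sd0 x : sup_dist x x = 0 by rewrite /sup_dist; lia.
have tB : vertices D t -> boundary_vertices D t by split=> //; exists s0.
elim=> [|n IH] u Du ut; (have [uB|uI] := boundary_or_interior Du;
    first by exists u; split=> //; rewrite ?sd0; lia).
  suff ut0 : u = t by exists u; rewrite sd0; split=> //; [rewrite ut0; apply: tB; rewrite -ut0|lia].
  case: u t ut {Du uI s0t tB} => a b [a' b']; rewrite /sup_dist /= => ut.
  by congr pair; lia.
have diag e e' : e = 1 \/ e = -1 -> e' = 1 \/ e' = -1 ->
    sup_dist (u.1 + e, u.2 + e') t <= n%:Z ->
  exists w, [/\ boundary_vertices D w, sup_dist u w <= n.+1%:Z &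
                h w <= h u + 2 * n.+1%:Z + 1].
  move=> he he' dt.
  have [m [s [s' [cs cs' sl sl' um]]]] := diagonal_step u he he'.
  have [|um_edge _ mD] := @interior_neighbor D u m uI; first by exists s; left.
  have [hum _] := step_bound um_edge cs sl.
  have [mB|mI] := boundary_or_interior mD; first by exists m; split=> //; lia.
  have [|mu'_edge _ u'D] := @interior_neighbor D m (u.1 + e, u.2 + e') mI.
    by exists s'; left.
  have [hmu' _] := step_bound mu'_edge cs' sl'.
  have [w [wB wd wh]] := IH _ u'D dt.
  exists w; split=> //; last by lia.
  by move: wd; rewrite /sup_dist /=; lia.
have straight : neighbors u t ->
  exists w, [/\ boundary_vertices D w, sup_dist u w <= n.+1%:Z &
                h w <= h u + 2 * n.+1%:Z + 1].
  move=> nut; have [ut_edge _ tD] := interior_neighbor uI nut.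
  exists t; split=> //; first exact: tB.
  have [s sl] := neighbors_left nut.
  case cs: (color s); first by have := step_bound ut_edge cs sl; lia.
  (* An edge with the color on its right can raise the height by 3, which is [2 * 1 + 1]: the
     additive 1 of the bound comes from here. *)
  have [s' sl' ss'] := on_left_across sl.
  have cs' : color s' by rewrite (hcolor ss') cs.
  by have := step_bound (edge_sym ut_edge) cs' sl'; lia.
(* In an aligned coordinate a diagonal step creates an offset of 1, too much only when [n] is 0. In
   that case [t] is [u] or one edge away. *)
have [/andP[n0 pq]|] := boolP ((n == 0)%N && ((t.1 == u.1) || (t.2 == u.2))).
  have [e0|ne0] := eqVneq u t.
    by exists u; split; [rewrite e0; apply: tB; rewrite -e0|rewrite sd0; lia|lia].
  apply: straight; case: u t pq ne0 ut {IH Du uI s0t tB diag} => a b [a' b'] /=.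
  rewrite /sup_dist /= => pq ne0 ut.
  have ne : a' != a \/ b' != b.
    have [ea|] := eqVneq a' a; [right|by left].
    by apply: contraNneq ne0 => ->; rewrite ea.
  case/orP: pq => /eqP e; subst.
    have [->|->] : b' = b + 1 \/ b = b' + 1 by lia.
      by exists (a - 1, b); left; rewrite /on_left /= !inE subrK eqxx ?orbT.
    by exists (a, b'); left; rewrite /on_left /= !inE eqxx ?orbT.
  have [->|->] : a' = a + 1 \/ a = a' + 1 by lia.
    by exists (a, b); left; rewrite /on_left /= !inE eqxx ?orbT.
  by exists (a', b); right; rewrite /on_left /= !inE eqxx ?orbT.
move=> nz; pose sg (x : int) : int := if 0 <= x then 1 else -1.
have sgP x : sg x = 1 \/ sg x = -1 by rewrite /sg; case: ifP; [left|right].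
apply: (diag (sg (t.1 - u.1)) (sg (t.2 - u.2))) => //.
move: ut nz; rewrite /sup_dist /sg /=; case: ifP; case: ifP; lia.
Qed.

End Walk.

Lemma height_function_step (black : pred square) (D : {fset square})
    (h : vertex -> int) : height_function black D h ->
  forall s u v, edge D u v -> black s -> on_left s u v ->
  h v <= h u + 1 /\ h u <= h v + 3.
Proof.
by move=> hh s u v uv bs suv; case: (hh u v uv) => _ /(_ s bs suv) []; lia.
Qed.

Lemma checkerboard_predC (black : pred square) :
  checkerboard black -> checkerboard (predC black).
Proof. by move=> hb s t st /=; rewrite (hb s t st). Qed.

(* Negating heights exchanges the two colors. *)
Lemma height_function_stepN (black : pred square) (D : {fset square})
    (h : vertex -> int) : checkerboard black -> height_function black D h ->
  forall s u v, edge D u v -> predC black s -> on_left s u v ->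
  - h v <= - h u + 1 /\ - h u <= - h v + 3.
Proof.
move=> hb hh s u v uv ws suv; have [t tvu st] := on_left_across suv.
have bt : black t by rewrite (hb s t st).
have := height_function_step hh (edge_sym uv) bt tvu; lia.
Qed.

Lemma height_boundary_bounds (black : pred square) (D : {fset square})
    (h : vertex -> int) (s0 : square) (t u : vertex) (n : nat) :
  checkerboard black -> height_function black D h ->
  s0 \notin D -> corner s0 t -> vertices D u -> sup_dist u t <= n%:Z ->
  (exists w, [/\ boundary_vertices D w, sup_dist u w <= n%:Z &
                 h w <= h u + 2 * n%:Z + 1]) /\
  (exists w, [/\ boundary_vertices D w, sup_dist u w <= n%:Z &
                 h u <= h w + 2 * n%:Z + 1]).
Proof.
move=> hb hh s0D s0t Du ut; split.
  exact: (height_near_boundary hb (height_function_step hh) s0D s0t Du ut).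
have [w [? ? hw]] := height_near_boundary (checkerboard_predC hb)
  (height_function_stepN hb hh) s0D s0t Du ut.
by exists w; split=> //; lia.
Qed.

(** * Comparison of the two heights at a boundary vertex *)

Lemma sup_distC (u v : vertex) : sup_dist u v = sup_dist v u.
Proof. by rewrite /sup_dist; lia. Qed.

(** Two staircases in [D'] lead from [u] to boundary vertices of [D'] still within [Delta1] of [u],
    where the hypothesis on boundary heights applies. One bounds [h' u] from below, the other from
    above, with a loss of at most [2 * Delta1 + 1]. *)
Lemma boundary_height_close (R : realType) (black : pred square)
    (D D' : {fset square}) (h h' : vertex -> int) (Delta1 Delta2 : R) :
  checkerboard black -> height_function black D' h' ->
  (forall u, boundary_vertices D u ->
     exists2 w, boundary_vertices D' w & (sup_dist u w)%:~R <= Delta1) ->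
  (forall u w, boundary_vertices D u -> boundary_vertices D' w ->
     (sup_dist u w)%:~R <= Delta1 -> `|h u - h' w|%:~R <= Delta2) ->
  forall u, boundary_vertices D u -> vertices D' u ->
  `|h u - h' u|%:~R <= 2 * Delta1 + Delta2 + 1.
Proof.
move=> hb hh' near close u uB uD'.
have [t [tD' [s0 s0D s0t]] ut] := near u uB.
(* The walks are measured by the actual distance to [t], an integer at most [Delta1]. *)
pose n := `|sup_dist u t|%N.
have nE : n%:Z = sup_dist u t by rewrite /n /sup_dist; lia.
have un : sup_dist u t <= n%:Z by rewrite nE.
have inball w : sup_dist u w <= n%:Z -> (sup_dist u w)%:~R <= Delta1.
  by move=> uw; apply: le_trans ut; rewrite ler_int -nE.
have [[w [wB uw hw]] [w' [wB' uw' hw']]] :=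
  height_boundary_bounds hb hh' s0D s0t uD' un.
suff bound x : boundary_vertices D' x -> sup_dist u x <= n%:Z ->
    `|h u - h' u| <= `|h u - h' x| + 2 * n%:Z + 1 ->
    `|h u - h' u|%:~R <= 2 * Delta1 + Delta2 + 1.
  (* The sign of [h u - h' u] decides between the two end points. *)
  have [|] : `|h u - h' u| <= `|h u - h' w| + 2 * n%:Z + 1 \/
      `|h u - h' u| <= `|h u - h' w'| + 2 * n%:Z + 1.
  - by clearbody n; lia.
  - exact: bound.
  - exact: bound.
move=> xB ux; rewrite -(ler_int R) !intrD intrM nE => le.
by have := close _ _ uB xB (inball _ ux); move: ut le; lra.
Qed.

(** * Finiteness and nonemptiness of the sets of extensions *)

Definition vertex_fset (D : {fset square}) : {fset vertex} :=
  [fset x in flatten [seq unzip1 (ccw_edges s) | s <- D]]%fset.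

Lemma vertex_fsetP (D : {fset square}) (u : vertex) :
  reflect (vertices D u) (u \in vertex_fset D).
Proof.
rewrite in_fset; apply: (iffP flatten_mapP) => -[s sD us]; by exists s.
Qed.

Lemma exists_outside (D : {fset square}) : exists s, s \notin D.
Proof.
exists ((\max_(s <- D) `|s.1|%N).+1%:Z, 0); apply/negP => sD.
by have := @leq_bigmax_seq _ (D : seq square) xpredT (fun s => `|s.1|%N) _ sD isT; rewrite /=; lia.
Qed.

(** Any fixed corner [t] of a square outside [D] can serve as the target of the walks. If [n] is the
    largest distance to it, each height is within [2 * n + 1] of the range of the prescribed
    boundary heights. *)
Lemma height_extension_bound (black : pred square) (D : {fset square})
    (f : vertex -> int) : checkerboard black ->
  exists N : nat, forall h : vertex -> int, height_function black D h ->
    {in boundary_vertices D, h =1 f} ->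
    forall u, vertices D u -> `|h u| <= N%:Z.
Proof.
move=> hb; have [s0 s0D] := exists_outside D.
have [t s0t] : exists t, corner s0 t.
  by exists s0; case: s0 s0D => a b _; rewrite /corner !inE eqxx.
pose n := (\max_(u <- vertex_fset D) `|sup_dist u t|)%N.
pose m := (\max_(u <- vertex_fset D) `|f u|)%N.
exists (m + 2 * n + 1)%N => h hh hf u Du.
have un : sup_dist u t <= n%:Z.
  have /vertex_fsetP uV := Du.
  have := @leq_bigmax_seq _ _ xpredT (fun u => `|sup_dist u t|%N) _ uV isT.
  by rewrite -/n; lia.
have fm w : boundary_vertices D w -> `|h w| <= m%:Z.
  move=> wB; rewrite hf ?inE//; have /vertex_fsetP wV := wB.1.
  have := @leq_bigmax_seq _ _ xpredT (fun u => `|f u|%N) _ wV isT.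
  by rewrite -/m; lia.
have [[w [wB _ hw]] [w' [wB' _ hw']]] :=
  height_boundary_bounds hb hh s0D s0t Du un.
by have := fm w wB; have := fm w' wB'; lia.
Qed.

Lemma finite_extensions (black : pred square) (D : {fset square})
    (f : vertex -> int) : checkerboard black ->
  finite_set (extensions black D (boundary_vertices D) f).
Proof.
move=> hb; have [N hN] := height_extension_bound D f hb.
(* Heights from [-N] to [N] are coded by ordinals through a shift by [N]; the default 0 is the value
   required off [D]. *)
pose F (g : {ffun vertex_fset D -> 'I_(2 * N).+1}) : {fsfun vertex -> int with 0} :=
  [fsfun u : vertex_fset D => (g u)%:Z - N%:Z | 0].
apply: (@sub_finite_set _ _ (F @` setT)); last exact/finite_image/finite_finset.
move=> h [hh hf h0]; exists [ffun u => inord (absz (h (val u) + N%:Z))] => //.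
apply/fsfunP => u; rewrite /F fsfun_ffun.
case: insubP => [x xV <-|/vertex_fsetP uV] /=; last by rewrite h0.
have /vertex_fsetP xD := valP x.
by have := hN h hh hf _ xD; rewrite ffunE; move: (h (fsval x)) => k hk; rewrite inordK; lia.
Qed.

Lemma extensions_neq0 (black : pred square) (D : {fset square})
    (f : vertex -> int) : region D -> mandated_boundary black D f ->
  extensions black D (boundary_vertices D) f !=set0.
Proof.
move=> [T DT] hf; have [h [hh _] hB] := hf T DT.
(* Values off the vertices of [D] are reset to 0, the normal form that [extensions] asks for. *)
pose g : {fsfun vertex -> int with 0} := [fsfun u in vertex_fset D => h u | 0].
have gE u : vertices D u -> g u = h u.
  by move=> /vertex_fsetP uV; rewrite fsfun_fun uV.
exists g; split=> [u v uv|u|u /vertex_fsetP uV].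
- have [Du Dv] : vertices D u /\ vertices D v.
    by case: uv => s sD [] /on_left_corner [su sv]; split; exists s.
  by rewrite !gE //; exact: hh.
- by rewrite inE => uB; rewrite gE; [apply: hB; rewrite inE | case: uB].
- by rewrite fsfun_fun (negPf uV).
Qed.

(** * Exchange of two height functions on a component *)

Definition splice (C : {fset vertex}) (h : {fsfun vertex -> int with 0})
    (g : vertex -> int) : {fsfun vertex -> int with 0} :=
  [fsfun u in (finsupp h `|` C)%fset => if u \in C then g u else h u | 0].

Lemma spliceE (C : {fset vertex}) (h : {fsfun vertex -> int with 0})
    (g : vertex -> int) (u : vertex) :
  splice C h g u = if u \in C then g u else h u.
Proof.
rewrite fsfun_fun in_fsetU mem_finsupp; case: ifP => //.
by case: (u \in C); rewrite ?orbT //; case: eqP.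
Qed.

(** On an edge that meets [C], an end outside [C] satisfies [h = h' + c], so the spliced function is
    [h' + c] at both ends. An edge that avoids [C] keeps [h]. No boundary vertex is in [C], so the
    values of [f] are kept. *)
Lemma splice_extensions (black : pred square) (D D' : {fset square})
    (f : vertex -> int) (h h' : {fsfun vertex -> int with 0}) (c : int)
    (C : {fset vertex}) :
  extensions black D (boundary_vertices D) f h -> height_function black D' h' ->
  (forall u, u \in C -> [/\ vertices D u, interior_vertex D u & interior_vertex D' u]) ->
  (forall u w, u \in C -> neighbors u w -> w \notin C -> h w = h' w + c) ->
  extensions black D (boundary_vertices D) f (splice C h (fun u => h' u + c)).
Proof.
move=> [hh hB h0] hh' CI Cc; split.
- move=> u w uw; have nuw : neighbors u w by case: uw => s _; exists s.
  have [uwC|] := boolP ((u \in C) || (w \in C)); last first.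
    by rewrite negb_or => /andP[/negPf uC /negPf wC]; rewrite !spliceE uC wC; exact: hh.
  have {uwC} [uw' nb hu hw] : [/\ edge D' u w, ~ boundary_edge D u w,
      splice C h (fun u => h' u + c) u = h' u + c &
      splice C h (fun u => h' u + c) w = h' w + c].
    rewrite !spliceE; case/orP: uwC => xC; have [_ xI xI'] := CI _ xC.
      have [_ nb _] := interior_neighbor xI nuw.
      have [uw' _ _] := interior_neighbor xI' nuw.
      by split=> //; rewrite ?xC //; case: ifPn => // /(Cc _ _ xC nuw).
    have nwu := neighbors_sym nuw.
    have [_ nb _] := interior_neighbor xI nwu.
    have [wu' _ _] := interior_neighbor xI' nwu.
    split; [exact: edge_sym| | |by rewrite xC].
      by case=> /edge_sym ? [s sD [?|?]]; apply: nb; split=> //; exists s; auto.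
    by case: ifPn => // /(Cc _ _ xC nwu).
  split=> [//|s bs suw]; rewrite hu hw.
  by have [_ /(_ s bs suw)] := hh' u w uw'; lia.
- move=> u uB; rewrite spliceE; case: ifP => [uC|_]; last exact: hB.
  move: uB; rewrite inE => -[_ [s /negP sD su]].
  by have [_ uI _] := CI _ uC; case: sD; apply: uI.
- move=> u Du; rewrite spliceE; case: ifP => [uC|_]; last exact: h0.
  by have [/Du] := CI _ uC.
Qed.

Inductive component (S : set vertex) (v : vertex) : vertex -> Prop :=
| component_start of S v : component S v v
| component_step u w of component S v u & neighbors u w & S w : component S v w.

Section Flip.
Variables (D1 D2 : {fset square}) (c : int) (v : vertex).
Local Notation height_pair := ({fsfun vertex -> int with 0} * {fsfun vertex -> int with 0})%type.

(** The condition is [<> c] and not [> c] because the exchange reflects the difference in [c]: this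
    way the set is invariant under [flip]. *)
Definition off_level (p : height_pair) : set vertex :=
  [set u | [/\ vertices D1 u, vertices D2 u & p.1 u - p.2 u <> c]].

Definition flip_set (p : height_pair) : {fset vertex} :=
  [fset u in vertex_fset D1 | `[< component (off_level p) v u >]]%fset.

Lemma component_sub (S : set vertex) (u : vertex) : component S v u -> S u.
Proof. by case. Qed.

Lemma flip_setP (p : height_pair) (u : vertex) :
  reflect (component (off_level p) v u) (u \in flip_set p).
Proof.
rewrite in_fset inE /=; apply: (iffP andP) => [[_ /asboolP]//|up].
by split; [apply/vertex_fsetP; case: (component_sub up)|apply/asboolP].
Qed.

Definition flip (p : height_pair) : height_pair :=
  (splice (flip_set p) p.1 (fun u => p.2 u + c),
   splice (flip_set p) p.2 (fun u => p.1 u - c)).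

Lemma flip_set_flip (p : height_pair) : flip_set (flip p) = flip_set p.
Proof.
suff off : off_level (flip p) = off_level p by rewrite /flip_set off.
have flipE w : (flip p).1 w - (flip p).2 w <> c <-> p.1 w - p.2 w <> c.
  by rewrite /= !spliceE; case: ifP => _; lia.
by apply/seteqP; split=> w [? ? /flipE].
Qed.

(** The second exchange takes place on the same set and undoes the first. This makes [flip]
    injective on all pairs. *)
Lemma flipK : involutive flip.
Proof.
move=> p; rewrite {1}/flip flip_set_flip; case: p => h1 h2.
by congr pair; apply/fsfunP => u; rewrite !spliceE; case: ifP => //= uC;
  rewrite uC; lia.
Qed.

End Flip.

Lemma flip_extensions (black : pred square) (D1 D2 : {fset square})
    (f1 f2 : vertex -> int) (c : int) (v : vertex)
    (h1 h2 : {fsfun vertex -> int with 0}) :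
  checkerboard black -> (c = 0 %[mod 4])%Z ->
  agree_mod4 black D1 (boundary_vertices D1) f1 D2 (boundary_vertices D2) f2 ->
  extensions black D1 (boundary_vertices D1) f1 h1 ->
  extensions black D2 (boundary_vertices D2) f2 h2 ->
  (forall u, vertices D1 u -> vertices D2 u ->
     boundary_vertices D1 u \/ boundary_vertices D2 u -> h1 u - h2 u <= c) ->
  vertices D1 v -> vertices D2 v -> c < h1 v - h2 v ->
  let: (k1, k2) := flip D1 D2 c v (h1, h2) in
  [/\ extensions black D1 (boundary_vertices D1) f1 k1,
      extensions black D2 (boundary_vertices D2) f2 k2 &
      k1 v - k2 v - c = - (h1 v - h2 v - c)].
Proof.
move=> hb c4 hmod Eh1 Eh2 bound D1v D2v.
move=> pos; set C := flip_set D1 D2 c v (h1, h2).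
have [hh1 _ _] := Eh1; have [hh2 _ _] := Eh2.
have CD u : u \in C -> [/\ vertices D1 u, vertices D2 u & h1 u - h2 u <> c].
  by move/flip_setP/component_sub.
have inside u : vertices D1 u -> vertices D2 u -> c < h1 u - h2 u ->
    interior_vertex D1 u /\ interior_vertex D2 u.
  move=> D1u D2u gt.
  have nB : ~ (boundary_vertices D1 u \/ boundary_vertices D2 u).
    by move=> /(bound u D1u D2u); lia.
  by have := boundary_or_interior D1u; have := boundary_or_interior D2u; tauto.
(* A difference above [c], being a multiple of 4, is at least [c + 4], and along an edge it changes
   by 0, 4 or -4. *)
have ge u w : vertices D1 u -> vertices D2 u -> c < h1 u - h2 u ->
    neighbors u w -> [/\ vertices D1 w, vertices D2 w & c <= h1 w - h2 w].
  move=> D1u D2u gt uw; have [I1 I2] := inside u D1u D2u gt.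
  have [e1 _ D1w] := interior_neighbor I1 uw.
  have [e2 _ D2w] := interior_neighbor I2 uw.
  split=> //.
  have m1 := hmod _ _ Eh1 Eh2 _ D1u D2u; have m2 := hmod _ _ Eh1 Eh2 _ D1w D2w.
  have [s suw] := neighbors_left uw.
  case bs: (black s).
    have [_ /(_ s bs suw) s1] := hh1 _ _ e1; have [_ /(_ s bs suw) s2] := hh2 _ _ e2.
    by move: gt m1 m2 s1 s2; lia.
  have [t twu st] := on_left_across suw; have bt : black t by rewrite (hb s t st) bs.
  have [_ /(_ t bt twu) s1] := hh1 _ _ (edge_sym e1).
  have [_ /(_ t bt twu) s2] := hh2 _ _ (edge_sym e2).
  by move: gt m1 m2 s1 s2; lia.
(* The component starts above [c]; each step keeps the difference at least [c], and the value [c] is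
   excluded. *)
have Cgt u : u \in C -> c < h1 u - h2 u.
  move/flip_setP; elim=> [_|{}u w uC gt uw [D1w D2w /= ne]]; first by lia.
  have [D1u D2u _] := component_sub uC.
  by have [_ _] := ge u w D1u D2u gt uw; lia.
have CI u : u \in C -> interior_vertex D1 u /\ interior_vertex D2 u.
  by move=> uC; have [? ? _] := CD u uC; apply: inside; rewrite ?Cgt.
(* A neighbor with a difference other than [c] would have joined the component. *)
have Ceq u w : u \in C -> neighbors u w -> w \notin C -> h1 w - h2 w = c.
  move=> uC uw; have [D1u D2u _] := CD u uC.
  have [D1w D2w _] := ge u w D1u D2u (Cgt u uC) uw.
  apply: contraNeq => /eqP ne; apply/flip_setP.
  by apply: component_step uw _; [apply/flip_setP|].
have vC : v \in C by apply/flip_setP; apply: component_start; split=> //=; lia.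
split; last by rewrite !spliceE -/C vC /=; lia.
apply: (@splice_extensions black D1 D2 f1 h1 h2 c) => // [u uC|u w uC uw wC].
    by have [? _ _] := CD u uC; have [] := CI u uC.
  by have := Ceq u w uC uw wC; lia.
apply: (@splice_extensions black D2 D1 f2 h2 h1 (- c)) => // [u uC|u w uC uw wC].
  by have [_ ? _] := CD u uC; have [] := CI u uC.
by have := Ceq u w uC uw wC; lia.
Qed.

(** * From the reflection of pairs to expectations *)

Lemma sum_le0_reflection (R : realType) (T : choiceType) (A : {fset T})
    (g : T -> R) (r : T -> T) : injective r ->
  (forall x, x \in A -> 0 < g x -> r x \in A /\ g (r x) = - g x) ->
  \sum_(x <- A) g x <= 0.
Proof.
move=> rinj rA; pose P := [fset x in A | 0 < g x]%fset.
pose Q := [fset r x | x in P]%fset.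
have QP x : x \in Q -> x \in A /\ g x < 0.
  by case/imfsetP => y /=; rewrite !inE /= => /andP[yA gy] ->;
    have [? ->] := rA y yA gy; rewrite oppr_lt0.
(* The sum is split into [P], its image [Q] and the rest. [P] and [Q] are disjoint by sign and
   cancel; the rest has no positive term. *)
rewrite (big_fsetID _ (fun x => 0 < g x)) -/P /=.
rewrite (big_fsetID _ (mem Q) [fset x in A | ~~ (0 < g x)]%fset) /= addrA.
have -> : [fset x in [fset x in A | ~~ (0 < g x)] | x \in Q]%fset = Q.
  apply/fsetP => x; rewrite !inE /= andbC; case xQ: (x \in Q) => //=.
  by have [-> gx] := QP x xQ; rewrite -leNgt ltW.
rewrite [X in _ + X + _]big_imfset /=; last by move=> ? ? _ _; exact: rinj.
rewrite -big_split /= big_seq big1 ?add0r; last first.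
  by move=> x; rewrite !inE /= => /andP[xA gx]; have [_ ->] := rA x xA gx; rewrite subrr.
rewrite big_seq; apply: sumr_le0 => x.
by rewrite !inE /= => /andP[/andP[_]]; rewrite -leNgt.
Qed.

(** Independence: the mean of [g p.1 - h p.2] over the product set is the difference of the two
    means. *)
Lemma mean_sub (R : realType) (T : choiceType) (A B : {fset T})
    (g h : T -> R) (c : R) : A != fset0 -> B != fset0 ->
  \sum_(p <- (A `*` B)%fset) (g p.1 - h p.2 - c) <= 0 ->
  (\sum_(x <- A) g x) / #|` A|%:R - (\sum_(x <- B) h x) / #|` B|%:R <= c.
Proof.
rewrite -!cardfs_gt0 => A0 B0.
have A0' : 0 < #|` A|%:R :> R by rewrite ltr0n.
have B0' : 0 < #|` B|%:R :> R by rewrite ltr0n.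
rewrite big_imfset2 /=; last by move=> [? ?] [? ?] _ _ /= [-> ->].
have -> : \sum_(x <- A) \sum_(y <- B) (g x - h y - c) =
    #|` B|%:R * \sum_(x <- A) g x - #|` A|%:R * \sum_(y <- B) h y
    - #|` A|%:R * #|` B|%:R * c.
  have cst (X : {fset T}) (k : R) : \sum_(x <- X) k = #|` X|%:R * k.
    by rewrite big_const_seq count_predT iter_addr_0 mulr_natl.
  under eq_bigr do rewrite !sumrB !cst.
  by rewrite !sumrB !cst -mulr_sumr mulrA.
move=> le0; rewrite -(ler_pM2r (mulr_gt0 A0' B0')).
have -> : ((\sum_(x <- A) g x) / #|` A|%:R - (\sum_(x <- B) h x) / #|` B|%:R) *
    (#|` A|%:R * #|` B|%:R) =
    #|` B|%:R * \sum_(x <- A) g x - #|` A|%:R * \sum_(y <- B) h y.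
  by field; rewrite !gt_eqF.
by rewrite -subr_le0; move: le0; rewrite [c * _]mulrC.
Qed.

Lemma expected_height_sub_le (R : realType) (black : pred square)
    (D1 D2 : {fset square}) (f1 f2 : vertex -> int) (K : R) :
  checkerboard black ->
  extensions black D1 (boundary_vertices D1) f1 !=set0 ->
  extensions black D2 (boundary_vertices D2) f2 !=set0 ->
  agree_mod4 black D1 (boundary_vertices D1) f1 D2 (boundary_vertices D2) f2 ->
  (forall h1 h2 u, extensions black D1 (boundary_vertices D1) f1 h1 ->
     extensions black D2 (boundary_vertices D2) f2 h2 ->
     vertices D1 u -> vertices D2 u ->
     boundary_vertices D1 u \/ boundary_vertices D2 u ->
     (h1 u - h2 u)%:~R <= K) ->
  forall v, vertices D1 v -> vertices D2 v ->
  expected_height R black D1 (boundary_vertices D1) f1 v -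
  expected_height R black D2 (boundary_vertices D2) f2 v <= K.
Proof.
move=> hb ne1 ne2 hmod hK v D1v D2v.
set E1 := extensions _ D1 _ _ in ne1 hK *; set E2 := extensions _ D2 _ _ in ne2 hK *.
have fin1 : finite_set E1 by exact: finite_extensions.
have fin2 : finite_set E2 by exact: finite_extensions.
have fset_neq0 (E : set {fsfun vertex -> int with 0}) :
    finite_set E -> E !=set0 -> fset_set E != fset0.
  move=> finE [h Eh]; apply/fset0Pn; exists h.
  by rewrite in_fset_set // inE.
have [c [c4 cK cmax]] : exists c : int, [/\ (c = 0 %[mod 4])%Z, c%:~R <= K &
    forall d : int, (d = 0 %[mod 4])%Z -> d%:~R <= K -> d <= c].
  exists (4 * Num.floor (K / 4)); split=> [| |d d4 dK]; first by lia.
    by have := Num.Theory.floor_le (K / 4); rewrite intrM; lra.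
  have [k dE] : exists k, d = 4 * k by exists (d %/ 4)%Z; lia.
  move: dK; rewrite dE intrM => kK; suff : k <= Num.floor (K / 4) by lia.
  by rewrite Num.Theory.floor_ge_int; lra.
(* The differences are multiples of 4, so the bound [K] on them improves to [c]. *)
have bound h1 h2 u : E1 h1 -> E2 h2 -> vertices D1 u -> vertices D2 u ->
    boundary_vertices D1 u \/ boundary_vertices D2 u -> h1 u - h2 u <= c.
  move=> Eh1 Eh2 D1u D2u uB; have := hK _ _ _ Eh1 Eh2 D1u D2u uB.
  by apply: cmax; have := hmod _ _ Eh1 Eh2 _ D1u D2u; lia.
apply: le_trans cK; rewrite /expected_height; apply: mean_sub;
  [exact: fset_neq0..|].
apply: (sum_le0_reflection (inv_inj (flipK D1 D2 c v))) => -[h1 h2].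
rewrite !in_fsetM /= !in_fset_set // => /andP[/set_mem Eh1 /set_mem Eh2].
rewrite -!intrB ltr0z subr_gt0 => pos.
have [eh1 eh2 ev] := flip_extensions hb c4 hmod Eh1 Eh2
  (fun u => bound h1 h2 u Eh1 Eh2) D1v D2v pos.
by split; [apply/andP; split; apply/mem_set|rewrite -intrN -ev].
Qed.

(** * The two-sided bound on the difference of expectations *)

Unset Implicit Arguments.

Theorem proposition20 (R : realType) (black : pred square)
    (D1 D2 : {fset square}) (f1 f2 : vertex -> int) (Delta1 Delta2 : R)
    (hblack : checkerboard black)
    (hD1 : region D1) (hD2 : region D2)
    (sc1 : simply_connected (carrier R D1))
    (sc2 : simply_connected (carrier R D2))
    (hf1 : mandated_boundary black D1 f1)
    (hf2 : mandated_boundary black D2 f2)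
    (hmod : agree_mod4 black D1 (boundary_vertices D1) f1
                             D2 (boundary_vertices D2) f2)
    (near12 : forall v1, boundary_vertices D1 v1 ->
       exists2 v2, boundary_vertices D2 v2 & (sup_dist v1 v2)%:~R <= Delta1)
    (near21 : forall v2, boundary_vertices D2 v2 ->
       exists2 v1, boundary_vertices D1 v1 & (sup_dist v1 v2)%:~R <= Delta1)
    (hclose : forall v1 v2, boundary_vertices D1 v1 -> boundary_vertices D2 v2 ->
       (sup_dist v1 v2)%:~R <= Delta1 -> `|f1 v1 - f2 v2|%:~R <= Delta2)
    (v : vertex) (hv1 : vertices D1 v) (hv2 : vertices D2 v) :
  `| expected_height R black D1 (boundary_vertices D1) f1 v
     - expected_height R black D2 (boundary_vertices D2) f2 v |
  <= 2 * Delta1 + Delta2 + 1.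
Proof.
have ne1 := extensions_neq0 hD1 hf1; have ne2 := extensions_neq0 hD2 hf2.
have bound h1 h2 u :
    extensions black D1 (boundary_vertices D1) f1 h1 ->
    extensions black D2 (boundary_vertices D2) f2 h2 ->
    vertices D1 u -> vertices D2 u ->
    boundary_vertices D1 u \/ boundary_vertices D2 u ->
    `|h1 u - h2 u|%:~R <= 2 * Delta1 + Delta2 + 1.
  (* The staircases run in [D2] when [u] is on the boundary of [D1], and in [D1] when it is on that
     of [D2]. *)
  move=> [hh1 hB1 _] [hh2 hB2 _] D1u D2u [] uB.
    apply: (boundary_height_close hblack hh2 near12) => // x y xB yB xy.
    by rewrite hB1 ?hB2 ?inE //; exact: hclose.
  rewrite distrC; apply: (boundary_height_close hblack hh1) uB D1u => [x xB|x y xB yB xy].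
    by have [y yB yx] := near21 x xB; exists y; rewrite // sup_distC.
  by rewrite hB1 ?hB2 ?inE // distrC; apply: hclose; rewrite // sup_distC.
(* The lower bound is the upper bound with the two regions exchanged. *)
rewrite ler_norml lerNl opprB; apply/andP; split.
  apply: (expected_height_sub_le hblack ne2 ne1) hv2 hv1.
    by move=> h2 h1 e2 e1 u D2u D1u; rewrite (hmod h1 h2).
  move=> h2 h1 u e2 e1 D2u D1u uB.
  apply: le_trans (bound h1 h2 u e1 e2 D1u D2u _); last by case: uB; auto.
  by rewrite ler_int distrC ler_norm.
apply: (expected_height_sub_le hblack ne1 ne2 hmod) hv1 hv2.
move=> h1 h2 u e1 e2 D1u D2u uB.
apply: le_trans (bound h1 h2 u e1 e2 D1u D2u uB).
by rewrite ler_int ler_norm.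
Qed.
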